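(* Let $0<\gamma_{\max}<1$. For $\psi\in\mathbb{R}^N$ with all $\psi_i>0$ put $f_i(\psi)=\psi_i+\sqrt{\psi_i}\sum_{j\in\Theta_{\varphi_i}}\sqrt{\psi_j}-\gamma_{\max}$, and consider the class of mappings $R_i(\psi)=\psi_i-\rho_i f_i(\psi)$, $i=1,\dots,N$, parameterized by scalars $\rho_i$ that may depend on the current iterate. For iterates $\psi(k)$ let $$\rho_i^*(k)=\begin{cases}\dfrac{2\sqrt{\psi_i(k)}}{2\sqrt{\psi_i(k)}+\sum_{j\in\Theta_{\varphi_i}}\sqrt{\psi_j(k)}} & \text{if } 1+\dfrac{1}{2\sqrt{\psi_i(k)}}\sum_{j\in\Theta_{\varphi_i}}\sqrt{\psi_j(k)}\ \ge\ \sum_{j\in\Theta_{\varphi_i}}\dfrac{\sqrt{\psi_i(k)}}{2\sqrt{\psi_j(k)}},\\[2mm] 0 & \text{otherwise.}\end{cases}$$ Then the mapping $\psi_i(k+1)=R_i(\psi(k))=\psi_i(k)-\rho_i^*(k)f_i(\psi(k))$, $i=1,\dots,N$, is a contraction mapping having the largest convergence speed among the mappings of the class above.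
   Context: There are $N>1$ nodes $1,\dots,N$. For a fixed time and a fixed packet loss realization, $\mathcal{N}_{\varphi_i}\subseteq\{1,\dots,N\}$ is the set of nodes whose packets are received by node $i$; it always contains $i$. For each $i$, $\Theta_{\varphi_i}=\{j\neq i:\mathcal{N}_{\varphi_i}\cap\mathcal{N}_{\varphi_j}\neq\emptyset\}\cup(\mathcal{N}_{\varphi_i}\setminus\{i\})$. The convergence speed of the mapping at node $i$ is measured by the scalar $$\alpha_i(k)=\big|1-\rho_i(k)\nabla_i f_i(\psi(k))\big|+\sum_{j\ne i}\big|\rho_i(k)\nabla_j f_i(\psi(k))\big|,$$ where $\nabla_j$ is the partial derivative with respect to $\psi_j$: the smaller $\alpha_i(k)$, the larger the convergence speed, so the largest convergence speed means that $\rho_i(k)=\rho_i^*(k)$ minimizes $\alpha_i(k)$ over all choices of $\rho_i(k)$. Contractivity is understood in the maximum norm, the corresponding condition being $\alpha_i(k)<1$ for all $i$.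
   Formalization: The contraction claim fails when the case test for ρ_i^* fails or is an equality (then α_i=1); it is proved, near ψ(k) with the ρ_i^*(k) held fixed, exactly when the test is strict for all i (iff α_i<1 for all i). Largest convergence speed is proved in full. *)

(* Defs.v *)
From HB Require Import structures.
From mathcomp Require Import all_boot all_order all_algebra.
From mathcomp Require Import all_classical all_reals all_analysis.

Set Implicit Arguments.
Unset Strict Implicit.
Unset Printing Implicit Defensive.

Import Order.TTheory GRing.Theory Num.Theory.
Import numFieldNormedType.Exports.

Local Open Scope ring_scope.

Definition Theta (N : nat) (Nphi : 'I_N -> {set 'I_N}) (i : 'I_N) : {set 'I_N} :=
  ([set j | (j != i) && (Nphi i :&: Nphi j != finset.set0)] :|: (Nphi i :\ i))%SET.

Definition f (R : realType) (N : nat) (Nphi : 'I_N -> {set 'I_N}) (gmax : R)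
    (i : 'I_N) (psi : 'rV[R]_N) : R :=
  psi 0 i
  + Num.sqrt (psi 0 i) * (\sum_(j in Theta Nphi i) Num.sqrt (psi 0 j)) - gmax.

Definition partial (R : realType) (N : nat) (j : 'I_N) (g : 'rV[R]_N -> R)
    (psi : 'rV[R]_N) : R :=
  'D_(delta_mx 0 j) g psi.

(* The coefficients rho_i are plain scalars: at a given iterate they are
   constants of the mapping, and a dependence of rho_i on the iterate is
   recovered by choosing rho after psi. *)
Definition Rmap (R : realType) (N : nat) (Nphi : 'I_N -> {set 'I_N}) (gmax : R)
    (rho : 'I_N -> R) (psi : 'rV[R]_N) : 'rV[R]_N :=
  \row_i (psi 0 i - rho i * f Nphi gmax i psi).

Definition alpha (R : realType) (N : nat) (Nphi : 'I_N -> {set 'I_N}) (gmax : R)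
    (rho : 'I_N -> R) (psi : 'rV[R]_N) (i : 'I_N) : R :=
  `|1 - rho i * partial i (f Nphi gmax i) psi|
  + \sum_(j < N | j != i) `|rho i * partial j (f Nphi gmax i) psi|.

Definition rho_star (R : realType) (N : nat) (Nphi : 'I_N -> {set 'I_N})
    (psi : 'rV[R]_N) (i : 'I_N) : R :=
  let s := \sum_(j in Theta Nphi i) Num.sqrt (psi 0 j) in
  if \sum_(j in Theta Nphi i) Num.sqrt (psi 0 i) / (2 * Num.sqrt (psi 0 j))
     <= 1 + 1 / (2 * Num.sqrt (psi 0 i)) * s
  then 2 * Num.sqrt (psi 0 i) / (2 * Num.sqrt (psi 0 i) + s)
  else 0.

(* The norm of 'rV[R]_N is the maximum norm. *)
Definition contraction_near (R : realType) (N : nat)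
    (g : 'rV[R]_N -> 'rV[R]_N) (psi : 'rV[R]_N) : Prop :=
  exists q : R, [/\ 0 <= q, q < 1 &
    exists2 U : set 'rV[R]_N, nbhs psi U &
      forall x y, U x -> U y -> `|g x - g y| <= q * `|x - y|].

(* Main.v *)
(* Writing u = sqrt x, v = sqrt y and w = u + v coordinatewise, the identity
   u_i u_j - v_i v_j = (w_j (u_i - v_i) + w_i (u_j - v_j)) / 2 together with
   x_k - y_k = w_k (u_k - v_k) gives
   f_i(x) - f_i(y) = \sum_k slope w i k * (x_k - y_k)
   exactly, for coefficients that are continuous in w.  At x = y = psi they are
   the partial derivatives of f_i, which yields alpha_i in closed form as
   |1 - rho D| + |rho| S; for x, y near psi they bound the Lipschitz constant of
   the mapping by a perturbation of alpha_i, hence by some q < 1 near psi. *)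

Require Import Defs.
From HB Require Import structures.
From mathcomp Require Import all_boot all_order all_algebra.
From mathcomp Require Import all_classical all_reals all_analysis.
From mathcomp Require Import ring lra.

Set Implicit Arguments.
Unset Strict Implicit.
Unset Printing Implicit Defensive.

Import Order.TTheory GRing.Theory Num.Theory.
Import numFieldNormedType.Exports.

Local Open Scope ring_scope.

Lemma sqrt_mul_sub (R : rcfType) (a b c d : R) :
  0 < a -> 0 < b -> 0 < c -> 0 < d ->
  Num.sqrt a * Num.sqrt b - Num.sqrt c * Num.sqrt d =
  (Num.sqrt b + Num.sqrt d) / (2 * (Num.sqrt a + Num.sqrt c)) * (a - c) +
  (Num.sqrt a + Num.sqrt c) / (2 * (Num.sqrt b + Num.sqrt d)) * (b - d).
Proof.
move=> a0 b0 c0 d0.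
(* The selected occurrences are those outside the roots; as squares they leave a rational identity
   in the four roots. *)
rewrite -{3}(sqr_sqrtr (ltW a0)) -{4}(sqr_sqrtr (ltW b0)).
rewrite -{3}(sqr_sqrtr (ltW c0)) -{4}(sqr_sqrtr (ltW d0)).
move: a0 b0 c0 d0; rewrite -(sqrtr_gt0 a) -(sqrtr_gt0 b) -(sqrtr_gt0 c) -(sqrtr_gt0 d).
move: (Num.sqrt a) (Num.sqrt b) (Num.sqrt c) (Num.sqrt d) => p q r s p0 q0 r0 s0.
by field; rewrite !gt_eqF ?addr_gt0.
Qed.

(** * Exact slopes between two points *)

Section Slopes.
Variables (R : realType) (N : nat) (Nphi : 'I_N -> {set 'I_N}) (gmax : R).
Implicit Types (w a : 'I_N -> R) (i j k : 'I_N) (x y psi : 'rV[R]_N).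

(** At [w] = sqrt psi, this and [cross_slope] are the D and S of the closed form of [alpha]: the
    diagonal partial derivative and the sum of the others. *)
Definition own_slope w i : R := 1 + \sum_(j in Theta Nphi i) w j / (2 * w i).

Definition cross_slope w i : R := \sum_(j in Theta Nphi i) w i / (2 * w j).

(** Homogeneous of degree 0 in [w], so one formula serves both two-point slopes ([w] a sum of two
    roots) and partial derivatives ([w] a single root). *)
Definition slope w i k : R :=
  if k == i then own_slope w i
  else if k \in Theta Nphi i then w i / (2 * w k) else 0.

Lemma Theta_irrefl i : i \notin Theta Nphi i.
Proof. by rewrite !inE eqxx. Qed.

(** Off-diagonal slopes vanish outside [Theta], and [F0] keeps them zero under [F]. Needed for [F]
    the identity, in [f_sub], and for [F] the absolute value, in [alphaE]. *)
Lemma sum_slope_neq w i (F : R -> R) (F0 : F 0 = 0) (c : 'I_N -> R) :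
  \sum_(k < N | k != i) F (slope w i k) * c k =
  \sum_(k in Theta Nphi i) F (w i / (2 * w k)) * c k.
Proof.
rewrite [RHS]big_mkcond [LHS]big_mkcond; apply: eq_bigr => k _ /=.
rewrite /slope; have [->|ki] := eqVneq k i.
  by rewrite (negbTE (Theta_irrefl i)).
by case: ifP => // _; rewrite F0 mul0r.
Qed.

Definition sqrt_sum x y i : R := Num.sqrt (x 0 i) + Num.sqrt (y 0 i).

Lemma f_sub x y i :
  (forall k, 0 < x 0 k) -> (forall k, 0 < y 0 k) ->
  f Nphi gmax i x - f Nphi gmax i y =
  \sum_k slope (sqrt_sum x y) i k * (x 0 k - y 0 k).
Proof.
move=> x0 y0; rewrite (bigD1 i) //=.
rewrite (@sum_slope_neq _ i id erefl) // {1}/slope eqxx /own_slope /f.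
rewrite /= mulrDl mul1r mulr_suml -[RHS]addrA -big_split /=.
have subE (a b c d e : R) : a + b - e - (c + d - e) = a - c + (b - d) by ring.
rewrite subE !mulr_sumr -sumrB; congr (_ + _); apply: eq_bigr => j _.
exact: sqrt_mul_sub.
Qed.

(** * Continuity of slopes and partial derivatives *)

Local Open Scope classical_set_scope.

Lemma cvg_slope (T : Type) (F : set_system T) {FF : Filter F}
    (w : T -> 'I_N -> R) a i k :
  (forall j, 0 < a j) -> (forall j, w t j @[t --> F] --> a j) ->
  slope (w t) i k @[t --> F] --> slope a i k.
Proof.
move=> a0 wa.
have quot j l : w t j / (2 * w t l) @[t --> F] --> a j / (2 * a l).
  apply: cvgM => //; apply: cvgV; first by rewrite gt_eqF // mulr_gt0.
  by apply: cvgM => //; apply: cvg_cst.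
rewrite /slope; case: ifP => _; last by case: ifP => _ //; apply: cvg_cst.
apply: cvgD; first exact: cvg_cst.
by apply: cvg_big => [|j _]; [exact: add_continuous|exact: quot].
Qed.

Lemma cvg_coord_sqrt (T : Type) (F : set_system T) {FF : Filter F}
    (u : T -> 'rV[R]_N) psi j :
  u t @[t --> F] --> psi -> Num.sqrt (u t 0 j) @[t --> F] --> Num.sqrt (psi 0 j).
Proof.
move=> upsi; apply: (cvg_comp (fun t => u t 0 j) Num.sqrt); last exact: sqrt_continuous.
exact: (cvg_comp u _ upsi (@coord_continuous _ _ _ 0 j psi)).
Qed.

Lemma near_pos psi : (forall k, 0 < psi 0 k) ->
  \forall x \near psi, forall k : 'I_N, 0 < (x : 'rV[R]_N) 0 k.
Proof.
move=> p0; apply: (@filter_forall _ _ _ (nbhs psi)) => k.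
exact: (cvgr_gt _ (@coord_continuous _ _ _ 0 k psi)).
Qed.

Lemma slopeZ c w i k : c != 0 -> slope (fun j => c * w j) i k = slope w i k.
Proof.
move=> c0.
have quot j l : c * w j / (2 * (c * w l)) = w j / (2 * w l).
  by rewrite mulrCA -mulf_div divff // mul1r.
rewrite /slope /own_slope; case: ifP => _; last by rewrite quot.
by congr (_ + _); apply: eq_bigr => j _; exact: quot.
Qed.

Lemma slope_diag psi i k :
  slope (sqrt_sum psi psi) i k = slope (fun j => Num.sqrt (psi 0 j)) i k.
Proof.
rewrite -[RHS](@slopeZ 2) ?pnatr_eq0 //; congr slope; apply/funext => j.
by rewrite /sqrt_sum -mulr2n mulr_natl.
Qed.

Lemma cvg_slope_diag (T : Type) (F : set_system T) {FF : Filter F}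
    (u v : T -> 'rV[R]_N) psi i k :
  (forall j, 0 < psi 0 j) -> u t @[t --> F] --> psi -> v t @[t --> F] --> psi ->
  slope (sqrt_sum (u t) (v t)) i k @[t --> F] -->
  slope (fun j => Num.sqrt (psi 0 j)) i k.
Proof.
move=> p0 up vp; rewrite -slope_diag; apply: cvg_slope => j.
  by rewrite addr_gt0 ?sqrtr_gt0.
by apply: cvgD; exact: cvg_coord_sqrt.
Qed.

(** Moving along coordinate [k] alone kills all other terms of [f_sub]: the difference quotient is
    itself a slope, and its limit follows by continuity, with no root differentiated. *)
Lemma partial_f psi i k : (forall j, 0 < psi 0 j) ->
  partial k (f Nphi gmax i) psi = slope (fun j => Num.sqrt (psi 0 j)) i k.
Proof.
move=> p0; pose u (h : R) : 'rV[R]_N := h *: delta_mx 0 k + psi.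
have u0 : u h @[h --> 0^'] --> psi.
  have : u h @[h --> (0 : R)] --> 0 *: delta_mx 0 k + psi.
    by apply: cvgD; [apply: cvgZ; [exact: cvg_id|exact: cvg_cst]|exact: cvg_cst].
  rewrite scale0r add0r; apply: cvg_trans; apply: cvg_app; exact: nbhs_dnbhs.
apply: cvg_lim => //.
apply: cvg_trans; last exact: (cvg_slope_diag p0 u0 (cvg_cst psi)).
(* Quotient and slope agree for nonzero [h] so small that all coordinates of [u h] stay positive. *)
apply: near_eq_cvg.
have := u0 _ (near_pos p0); rewrite /nbhs /= => upos.
near=> h.
have h0 : h != 0 by near: h; exact: nbhs_dnbhs_neq.
have uh : forall j, 0 < u h 0 j by near: h.
rewrite -/(u h) (f_sub i uh p0) (bigD1 k) //= big1 => [|l lk].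
  by rewrite /u !mxE !eqxx addr0 mulr1 addrK /GRing.scale /= mulrCA mulVf ?mulr1.
by rewrite /u !mxE (negbTE lk) andbF mulr0 add0r subrr mulr0.
Unshelve. all: by end_near. Qed.

(** * Closed form of [alpha] and local Lipschitz bounds *)

Lemma alphaE rho psi i : (forall j, 0 < psi 0 j) ->
  let w j := Num.sqrt (psi 0 j) in
  alpha Nphi gmax rho psi i =
  `|1 - rho i * own_slope w i| + `|rho i| * cross_slope w i.
Proof.
move=> p0 w; rewrite /alpha partial_f // {1}/slope eqxx; congr (_ + _).
under eq_bigr => k _ do rewrite partial_f // normrM mulrC.
rewrite (sum_slope_neq _ _ (normr0 R)) mulr_sumr.
by apply: eq_bigr => j _; rewrite mulrC [`|_ / _|]ger0_norm.
Qed.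

(** The factor is [alpha] with the partial derivatives replaced by slopes between [x] and [y], hence
    close to [alpha] when both points are near psi. *)
Lemma Rmap_coord_le rho x y i :
  (forall k, 0 < x 0 k) -> (forall k, 0 < y 0 k) ->
  `|(Rmap Nphi gmax rho x - Rmap Nphi gmax rho y) 0 i| <=
  (`|1 - rho i * slope (sqrt_sum x y) i i| +
   \sum_(k < N | k != i) `|rho i * slope (sqrt_sum x y) i k|) * `|x - y|.
Proof.
move=> x0 y0; set w := sqrt_sum x y.
have le_norm k : `|x 0 k - y 0 k| <= `|x - y|.
  have -> : x 0 k - y 0 k = (x - y) 0 k by rewrite !mxE.
  rewrite [leRHS]mx_normrE.
  exact: (le_bigmax _ (fun ij => `|(x - y) ij.1 ij.2|) (0, k)).
have -> : (Rmap Nphi gmax rho x - Rmap Nphi gmax rho y) 0 i =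
    (1 - rho i * slope w i i) * (x 0 i - y 0 i) -
    \sum_(k < N | k != i) rho i * slope w i k * (x 0 k - y 0 k).
  have := f_sub i x0 y0; rewrite (bigD1 i) //= -/w => fE.
  rewrite !mxE; under eq_bigr do rewrite -mulrA.
  rewrite -mulr_sumr; move: fE; set s := \sum_(k < N | _) _ => fE.
  have -> : x 0 i - rho i * f Nphi gmax i x - (y 0 i - rho i * f Nphi gmax i y)
    = x 0 i - y 0 i - rho i * (f Nphi gmax i x - f Nphi gmax i y) by ring.
  by rewrite fE; ring.
rewrite [leRHS]mulrDl [in leRHS]mulr_suml; apply: (le_trans (ler_normB _ _)); apply: lerD.
  by rewrite normrM ler_wpM2l.
apply: (le_trans (ler_norm_sum _ _ _)); apply: ler_sum => k _.
by rewrite normrM ler_wpM2l.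
Qed.

Lemma contraction_near_Rmap rho psi : (forall j, 0 < psi 0 j) ->
  (forall i, alpha Nphi gmax rho psi i < 1) ->
  contraction_near (Rmap Nphi gmax rho) psi.
Proof.
move=> p0 a1; pose m := \big[Num.max/0]_i alpha Nphi gmax rho psi i.
have m1 : m < 1 by apply: bigmax_lt => // i _; exact: a1.
have m0 : 0 <= m by exact: bigmax_ge_id.
have am i : alpha Nphi gmax rho psi i <= m by exact: le_bigmax.
(* The midpoint between [m] and 1 leaves room for perturbing every [alpha], and still lies below
   1. *)
exists ((m + 1) / 2); split; [lra|lra|].
have : \forall z \near (psi, psi), forall i,
    `|1 - rho i * slope (sqrt_sum z.1 z.2) i i| +
    \sum_(k < N | k != i) `|rho i * slope (sqrt_sum z.1 z.2) i k| < (m + 1) / 2.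
  apply: (@filter_forall _ _ _ (nbhs (psi, psi))) => i.
  apply: (cvgr_lt (alpha Nphi gmax rho psi i)); last first.
    have := am i; lra.
  have sl k : slope (sqrt_sum z.1 z.2) i k @[z --> (psi, psi)] -->
      partial k (f Nphi gmax i) psi.
    by rewrite partial_f //; apply: cvg_slope_diag => //;
      [exact: cvg_fst|exact: cvg_snd].
  have rs k : rho i * slope (sqrt_sum z.1 z.2) i k @[z --> (psi, psi)] -->
      rho i * partial k (f Nphi gmax i) psi.
    by apply: cvgM => //; exact: cvg_cst.
  apply: cvgD; first by apply: cvg_norm; apply: cvgB => //; exact: cvg_cst.
  by apply: cvg_big => [|k _]; [exact: add_continuous|exact: cvg_norm].
case=> -[A B] /= [nA nB] AB.
(* Both points must range over one neighbourhood, so the two sides of the product neighbourhood are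
   intersected. *)
exists (A `&` B `&` [set x | forall k, 0 < x 0 k]).
  by apply: filterI; [exact: filterI|exact: near_pos].
move=> x y [[Ax _] x0] [[_ By] y0].
rewrite [leLHS]mx_normrE; apply: bigmax_le => [|[i0 i] _ /=].
  by rewrite mulr_ge0 //; lra.
rewrite (ord1 i0); apply: (le_trans (Rmap_coord_le rho i x0 y0)).
by rewrite ler_wpM2r // ltW //; exact: (AB (x, y)).
Qed.

End Slopes.

(** * Scalar minimization of |1 - t D| + |t| S *)

Section OptimalCoefficient.
Variables (R : realFieldType) (D S : R).
Hypotheses (D_gt0 : 0 < D) (S_ge0 : 0 <= S).

(** The objective is convex and piecewise linear in t with kinks at 0 and 1/D; comparing S with D
    tells which kink is the minimum. *)
Let r : R := if S <= D then D^-1 else 0.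

Lemma optimal_value :
  `|1 - r * D| + `|r| * S = if S <= D then S / D else 1.
Proof.
rewrite /r; case: ifP => _; last by rewrite mul0r subr0 normr0 normr1 mul0r addr0.
by rewrite mulVf ?gt_eqF // subrr normr0 add0r gtr0_norm ?invr_gt0 // mulrC.
Qed.

Lemma optimal_value_le t : `|1 - r * D| + `|r| * S <= `|1 - t * D| + `|t| * S.
Proof.
have tri : 1 - `|t| * D <= `|1 - t * D|.
  by have := lerB_dist 1 (t * D); rewrite normr1 normrM (gtr0_norm D_gt0).
(* For D < S, the term |t| S makes up for the loss |t| D in [tri]. *)
rewrite optimal_value; case: (leP S D) => SD; last first.
  by have := ler_wpM2l (normr_ge0 t) (ltW SD); lra.
rewrite ler_pdivrMr //.
have := normr_ge0 (1 - t * D); have := normr_ge0 t.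
move: tri; set a := `|1 - t * D|; set b := `|t| => tri b0 a0.
(* The sum of this and S times [tri] is the goal S <= (a + b S) D. *)
have : 0 <= a * (D - S) by rewrite mulr_ge0 // subr_ge0.
have : 0 <= S * (a - (1 - b * D)) by rewrite mulr_ge0 // subr_ge0.
by lra.
Qed.

(** The minimum is 1 at S = D as well as beyond it, so the strict test is the exact one. *)
Lemma optimal_value_lt1 : (`|1 - r * D| + `|r| * S < 1) = (S < D).
Proof.
rewrite optimal_value; case: (leP S D) => SD; first by rewrite ltr_pdivrMr // mul1r.
by rewrite ltxx; apply/esym/negbTE; rewrite -leNgt ltW.
Qed.

End OptimalCoefficient.

Theorem proposition4p6 (R : realType) (N : nat) (Nphi : 'I_N -> {set 'I_N})
    (gmax : R) (psi : 'rV[R]_N)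
    (N_gt1 : (1 < N)%N)
    (Nphi_self : forall i : 'I_N, i \in Nphi i)
    (gmax01 : 0 < gmax < 1)
    (psi_gt0 : forall i : 'I_N, 0 < psi 0 i) :
  [/\ (* largest convergence speed: rho_star minimizes every alpha_i *)
      forall (rho : 'I_N -> R) (i : 'I_N),
        alpha Nphi gmax (rho_star Nphi psi) psi i <= alpha Nphi gmax rho psi i,
      (* alpha_i < 1 for all i, exactly when the tests hold strictly *)
      (forall i : 'I_N, alpha Nphi gmax (rho_star Nphi psi) psi i < 1) <->
      (forall i : 'I_N,
        \sum_(j in Theta Nphi i) Num.sqrt (psi 0 i) / (2 * Num.sqrt (psi 0 j))
        < 1 + 1 / (2 * Num.sqrt (psi 0 i))
              * \sum_(j in Theta Nphi i) Num.sqrt (psi 0 j)) &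
      (* and then the mapping is a contraction in the maximum norm *)
      (forall i : 'I_N, alpha Nphi gmax (rho_star Nphi psi) psi i < 1) ->
      contraction_near (Rmap Nphi gmax (rho_star Nphi psi)) psi].
Proof.
pose w j := Num.sqrt (psi 0 j).
have w_gt0 j : 0 < w j by rewrite sqrtr_gt0.
have ownE i : own_slope Nphi w i =
    1 + 1 / (2 * w i) * \sum_(j in Theta Nphi i) w j.
  by rewrite /own_slope -mulr_suml mul1r [in RHS]mulrC.
have D_gt0 i : 0 < own_slope Nphi w i.
  by rewrite ltr_pwDl // sumr_ge0 // => j _; rewrite divr_ge0 ?mulr_ge0 ?ltW.
have S_ge0 i : 0 <= cross_slope Nphi w i.
  by rewrite sumr_ge0 // => j _; rewrite divr_ge0 ?mulr_ge0 ?ltW.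
(* The quotient in [rho_star] is 1/D with numerator and denominator multiplied by 2 sqrt psi_i. *)
have rhoE i : rho_star Nphi psi i =
    if cross_slope Nphi w i <= own_slope Nphi w i then (own_slope Nphi w i)^-1
    else 0.
  rewrite /rho_star -/(w _) -ownE /cross_slope; case: ifP => // _.
  have s_ge0 : 0 <= \sum_(j in Theta Nphi i) w j
    by rewrite sumr_ge0 // => j _; rewrite ltW.
  have wi := w_gt0 i; rewrite ownE; field.
  by rewrite !gt_eqF //; lra.
split=> [rho i||a1]; last exact: contraction_near_Rmap.
  by rewrite !alphaE // rhoE optimal_value_le.
have lt1 i : (alpha Nphi gmax (rho_star Nphi psi) psi i < 1) =
    (cross_slope Nphi w i < own_slope Nphi w i).
  by rewrite alphaE // rhoE optimal_value_lt1.
by split=> h i; have := h i; rewrite lt1 ownE.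
Qed.
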